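(* Let $G$ be a finite simple triangle-free graph with maximum degree $\Delta(G)\leq 4$. Then $$\frac{7}{4}\alpha(G)+\beta(G)\geq n(G),$$ with equality if and only if every connected component $C$ of $G$ satisfies $n(C)=13$, $\alpha(C)=4$, and $\beta(C)=6$.
   Context: All graphs are simple, finite and undirected. $n(G)$ is the number of vertices of $G$, $\alpha(G)$ is the independence number (maximum size of a set of pairwise non-adjacent vertices), and $\beta(G)$ is the matching number (maximum number of pairwise disjoint edges). Triangle-free means $G$ contains no $K_3$ as a subgraph. *)

(* Defs.v *)
From mathcomp Require Import all_boot.
Set Implicit Arguments.
Unset Strict Implicit.
Unset Printing Implicit Defensive.

Section Graphs.
Variable T : finType.
Variable e : rel T.

Definition simple_graph : Prop := symmetric e /\ irreflexive e.

Definition triangle_free : Prop :=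
  forall x y z : T, e x y -> e y z -> e x z -> False.

Definition max_degree_le (k : nat) : Prop :=
  forall x : T, #|[set y | e x y]| <= k.

Definition independent_in (A S : {set T}) : bool :=
  (S \subset A) && [forall x in S, forall y in S, ~~ e x y].

Definition alpha_on (A : {set T}) : nat :=
  \max_(S : {set T} | independent_in A S) #|S|.

Definition matching_in (A : {set T}) (M : {set {set T}}) : bool :=
  [forall E in M, exists x, exists y,
      [&& x \in A, y \in A, e x y & E == [set x; y]]] && trivIset M.

Definition beta_on (A : {set T}) : nat :=
  \max_(M : {set {set T}} | matching_in A M) #|M|.

Definition alpha : nat := alpha_on [set: T].
Definition beta : nat := beta_on [set: T].

Definition component (x : T) : {set T} := [set y | connect e x y].

End Graphs.

(* Main.v *)
(** Induct on the vertex set A.  If A splits into two parts without edges between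
    them, alpha, beta and n are additive.  If deleting some vertex v lowers beta,
    the bound for A minus v gives the one for A.  Otherwise Gallai's lemma yields
    n = 2 beta + 1, and Shearer's bound for triangle-free graphs,
    alpha >= (127/425) n when Delta <= 4, together with integrality gives the
    inequality, strict unless n = 13 and alpha = 4.

    A 13-vertex graph with alpha = 4 is 4-regular: if deg v <= 3, removing v and
    its neighbours leaves at least 9 vertices with alpha <= 3, hence Delta <= 3,
    against Shearer's bound (17/50) n.  So a deleted vertex cannot be adjacent to
    an extremal block; it is isolated, and the bound is then strict. *)

Require Import Defs.
From mathcomp Require Import all_boot zify.
Set Implicit Arguments.
Unset Strict Implicit.
Unset Printing Implicit Defensive.

Section Sets.
Variables (T : finType) (e : rel T).
Hypotheses (e_sym : symmetric e) (e_irr : irreflexive e).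
Implicit Types (A B S : {set T}) (M N : {set {set T}}) (u v w x y : T).

(** * Independent sets inside a vertex subset *)

Lemma independentP A S :
  reflect (S \subset A /\ {in S &, forall x y, ~~ e x y}) (independent_in e A S).
Proof.
apply: (iffP andP) => -[sSA H]; split=> //.
  by move=> x y Sx Sy; move/forall_inP/(_ x Sx)/forall_inP/(_ y Sy): H.
by apply/forall_inP => x Sx; apply/forall_inP => y Sy; exact: H.
Qed.

Lemma independent0 A : independent_in e A set0.
Proof. by apply/independentP; rewrite sub0set; split=> // x y; rewrite inE. Qed.

Lemma leq_alpha A S : independent_in e A S -> #|S| <= alpha_on e A.
Proof. by move=> SA; apply: (bigmax_sup S). Qed.

Lemma alpha_witness A : exists2 S, independent_in e A S & #|S| = alpha_on e A.
Proof.
rewrite /alpha_on (bigmax_eq_arg _ (independent0 A)).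
by case: arg_maxnP => [|S SA _]; [apply: independent0 | exists S].
Qed.

Lemma alpha_sub A B : A \subset B -> alpha_on e A <= alpha_on e B.
Proof.
move=> sAB; have [S /independentP[sSA iS] <-] := alpha_witness A.
by apply: leq_alpha; apply/independentP; split=> //; apply: subset_trans sAB.
Qed.

Lemma alpha_le_setID A B : alpha_on e A <= alpha_on e (A :&: B) + alpha_on e (A :\: B).
Proof.
have [S /independentP[sSA iS] <-] := alpha_witness A.
rewrite -(cardsID B S); apply: leq_add; apply: leq_alpha; apply/independentP.
  by split=> [|x y /setIP[Sx _] /setIP[Sy _]]; [apply: setSI | exact: iS].
by split=> [|x y /setDP[Sx _] /setDP[Sy _]]; [apply: setSD | exact: iS].
Qed.

Definition nbr A v := [set y in A | e v y].

(** An independent set avoiding [v] and its neighbours can be enlarged by [v]. *)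
Lemma alphaU1 A v : v \in A ->
  alpha_on e (A :\: (v |: nbr A v)) < alpha_on e A.
Proof.
move=> Av; have [S /independentP[sS iS] <-] := alpha_witness (A :\: (v |: nbr A v)).
have vS : v \notin S.
  by apply/negP => /(subsetP sS); rewrite !inE eqxx.
have nv x : x \in S -> ~~ e v x.
  move/(subsetP sS); rewrite !inE negb_or negb_and => /andP[/andP[_]].
  by case: (x \in A) => //=.
have -> : #|S|.+1 = #|v |: S| by rewrite cardsU1 vS.
apply: leq_alpha; apply/independentP; split.
  rewrite subUset sub1set Av /=; apply: subset_trans sS _; exact: subsetDl.
move=> x y /setU1P[->|Sx] /setU1P[->|Sy]; rewrite ?e_irr ?nv //.
  by rewrite e_sym nv.
exact: iS.
Qed.

(** * Subsets closed under adjacency *)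

(** These are the unions of components of the graph induced on [A]. *)
Definition detached A B :=
  (B \subset A) && [forall x in B, forall y in A, e x y ==> (y \in B)].

Lemma detachedP A B :
  reflect (B \subset A /\ forall x y, x \in B -> y \in A -> e x y -> y \in B)
          (detached A B).
Proof.
apply: (iffP andP) => -[sBA H]; split=> //.
  by move=> x y Bx Ay; move/forall_inP/(_ x Bx)/forall_inP/(_ y Ay)/implyP: H.
apply/forall_inP => x Bx; apply/forall_inP => y Ay; apply/implyP; exact: H.
Qed.

Lemma detachedD A B : detached A B -> detached A (A :\: B).
Proof.
case/detachedP=> sBA H; apply/detachedP; split=> [|x y /setDP[Ax nBx] Ay exy].
  exact: subsetDl.
rewrite inE Ay andbT; apply: contra nBx => By.
by apply: H By Ax _; rewrite e_sym.
Qed.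

Lemma detached_trans A B C : detached A B -> detached B C -> detached A C.
Proof.
case/detachedP=> sBA HB /detachedP[sCB HC]; apply/detachedP; split.
  exact: subset_trans sBA.
move=> x y Cx Ay exy; apply: (HC x) => //; apply: (HB x) => //.
exact: (subsetP sCB).
Qed.

Lemma alpha_detached A B : detached A B ->
  alpha_on e A = alpha_on e B + alpha_on e (A :\: B).
Proof.
case/detachedP=> sBA H; apply/eqP; rewrite eqn_leq.
have := alpha_le_setID A B; rewrite (setIidPr sBA) => -> /=.
have [S /independentP[sS iS] <-] := alpha_witness B.
have [U /independentP[sU iU] <-] := alpha_witness (A :\: B).
have nSU x y : x \in S -> y \in U -> ~~ e x y.
  move=> Sx Uy; have /setDP[Ay nBy] := subsetP sU _ Uy.
  by apply: contra nBy => exy; apply: (H x) => //; apply: (subsetP sS).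
rewrite -cardsUI.
have -> : S :&: U = set0.
  apply/setP => x; rewrite !inE; apply/andP => -[Sx Ux].
  by have /setDP[_ /negP[]] := subsetP sU _ Ux; apply: (subsetP sS).
rewrite cards0 addn0.
apply: leq_alpha; apply/independentP; split.
  rewrite subUset (subset_trans sS sBA); exact: subset_trans sU (subsetDl _ _).
move=> x y /setUP[Sx|Ux] /setUP[Sy|Uy].
- exact: iS.
- exact: nSU.
- by rewrite e_sym; apply: nSU.
- exact: iU.
Qed.

(** * Matchings inside a vertex subset *)

Definition edge_in A (E : {set T}) :=
  exists x y, [/\ x \in A, y \in A, e x y & E = [set x; y]].

Lemma matchingP A M :
  reflect ((forall E, E \in M -> edge_in A E) /\ trivIset M) (matching_in e A M).
Proof.
apply: (iffP andP) => -[H tM]; split=> //.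
  move=> E /(forall_inP H)/existsP[x /existsP[y /and4P[Ax Ay exy /eqP->]]].
  by exists x, y.
apply/forall_inP => E /H [x [y [Ax Ay exy ->]]].
by apply/existsP; exists x; apply/existsP; exists y; rewrite Ax Ay exy eqxx.
Qed.

Lemma edge_card A E : edge_in A E -> #|E| = 2.
Proof.
case=> x [y [_ _ exy ->]]; rewrite cards2; case: eqP exy => // ->.
by rewrite e_irr.
Qed.

Lemma edge_sub A B E : A \subset B -> edge_in A E -> edge_in B E.
Proof.
move=> /subsetP sAB [x [y [Ax Ay exy ->]]].
by exists x, y; split=> //; apply: sAB.
Qed.

Lemma edge_vsub A E : edge_in A E -> E \subset A.
Proof. by case=> x [y [Ax Ay _ ->]]; rewrite subUset !sub1set Ax. Qed.

Lemma matching_cover_sub A M : matching_in e A M -> cover M \subset A.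
Proof.
by case/matchingP=> H _; apply/bigcupsP => E EM; apply: edge_vsub (H _ EM).
Qed.

Lemma matching_cover_card A M : matching_in e A M -> #|cover M| = #|M| * 2.
Proof.
case/matchingP=> H /eqP <-; rewrite -sum_nat_const.
by apply: eq_bigr => E /H /edge_card.
Qed.

Lemma matching0 A : matching_in e A set0.
Proof.
apply/matchingP; split=> [E|]; first by rewrite inE.
by apply/trivIsetP => E F; rewrite inE.
Qed.

Lemma matchingS A M N : N \subset M -> matching_in e A M -> matching_in e A N.
Proof.
move=> sNM /matchingP[H tM]; apply/matchingP; split; last exact: trivIsetS tM.
by move=> E /(subsetP sNM)/H.
Qed.

Lemma matching_restrict A B M : matching_in e A M ->
  (forall E, E \in M -> edge_in B E) -> matching_in e B M.
Proof. by case/matchingP => _ tM H; apply/matchingP. Qed.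

Lemma matchingU1 A M E : matching_in e A M -> edge_in A E ->
  [disjoint E & cover M] -> matching_in e A (E |: M) /\ #|E |: M| = #|M|.+1.
Proof.
move=> mM AE dE; have [H tM] := matchingP _ _ mM.
have dEF F : F \in M -> [disjoint E & F].
  by move=> FM; apply: disjointWr dE; apply: bigcup_sup FM.
have nEM : E \notin M.
  apply/negP => /dEF; rewrite -setI_eq0 setIid => /eqP E0.
  by have := edge_card AE; rewrite E0 cards0.
split; last by rewrite cardsU1 nEM.
apply/matchingP; split=> [F /setU1P[->//|]|]; first exact: H.
apply/trivIsetP => F1 F2 /setU1P[->|F1M] /setU1P[->|F2M] nF.
- by rewrite eqxx in nF.
- exact: dEF.
- by rewrite disjoint_sym dEF.
- exact: (trivIsetP tM).
Qed.

Lemma leq_beta A M : matching_in e A M -> #|M| <= beta_on e A.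
Proof. by move=> MA; apply: (bigmax_sup M). Qed.

Lemma beta_witness A : exists2 M, matching_in e A M & #|M| = beta_on e A.
Proof.
rewrite /beta_on (bigmax_eq_arg _ (matching0 A)).
by case: arg_maxnP => [|M MA _]; [apply: matching0 | exists M].
Qed.

(** No edge joins [B] to the rest of [A], so a matching of [A] splits into one on each side, and two
    such matchings can be united. *)
Lemma beta_detached A B : detached A B ->
  beta_on e A = beta_on e B + beta_on e (A :\: B).
Proof.
move=> dAB; have [sBA H] := detachedP _ _ dAB; apply/eqP; rewrite eqn_leq.
apply/andP; split.
  have [M mM <-] := beta_witness A; have [HM _] := matchingP _ _ mM.
  rewrite -(cardsID [set E : {set T} | E \subset B] M); apply: leq_add; apply: leq_beta.
    apply: (matching_restrict (A := A)).
      by apply: matchingS mM; apply: subsetIl.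
    move=> E /setIP[/HM[x [y [Ax Ay exy ->]]]].
    by rewrite inE subUset !sub1set => /andP[Bx By]; exists x, y.
  apply: (matching_restrict (A := A)).
    by apply: matchingS mM; apply: subsetDl.
  move=> E /setDP[/HM[x [y [Ax Ay exy ->]]]].
  rewrite inE subUset !sub1set => nB; exists x, y; split=> //; rewrite inE ?Ax ?Ay andbT.
    by apply: contra nB => Bx; rewrite Bx (H x).
  by apply: contra nB => By; rewrite By (H y) // e_sym.
have [M mM <-] := beta_witness B.
have [N mN <-] := beta_witness (A :\: B).
have sM := matching_cover_sub mM; have sN := matching_cover_sub mN.
have [HM tM] := matchingP _ _ mM; have [HN tN] := matchingP _ _ mN.
have dBD : [disjoint B & A :\: B] by rewrite -setI_eq0 setIDA setD_eq0 subsetIl.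
have dMN : [disjoint cover M & cover N] by apply: disjointWl sM (disjointWr sN _).
have dEF E F : E \in M -> F \in N -> [disjoint E & F].
  move=> EM FN; apply: disjointWl (bigcup_sup E EM) (disjointWr _ dMN).
  exact: (bigcup_sup F FN).
have I0 : M :&: N = set0.
  apply/setP => E; rewrite !inE; apply/andP => -[EM EN].
  have := dEF _ _ EM EN; rewrite -setI_eq0 setIid => /eqP E0.
  by have := edge_card (HM _ EM); rewrite E0 cards0.
rewrite -cardsUI I0 cards0 addn0; apply: leq_beta; apply/matchingP; split.
  move=> E /setUP[/HM|/HN]; apply: edge_sub => //; exact: subsetDl.
apply/trivIsetP => E F /setUP[EM|EN] /setUP[FM|FN] nEF.
- exact: (trivIsetP tM).
- exact: dEF.
- by rewrite disjoint_sym dEF.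
- exact: (trivIsetP tN).
Qed.

(** * Gallai's lemma *)

Lemma maximum_matching_edge A M u v : matching_in e A M -> #|M| = beta_on e A ->
  u \in A -> v \in A -> e u v -> (u \in cover M) || (v \in cover M).
Proof.
move=> mM bM Au Av euv; apply/norP => -[nu nv].
have dE : [disjoint [set u; v] & cover M].
  apply/pred0P => x /=; rewrite !inE.
  by case: eqP => [->|_]; [apply: negbTE | case: eqP => [->|_//]; apply: negbTE].
have [] := matchingU1 mM _ dE; first by exists u, v.
by move=> /leq_beta le1 eq1; move: le1; rewrite eq1 bM ltnn.
Qed.

(* Among the maximum matchings missing v, take N sharing as many edges as
   possible with M.  If N covered u and w, counting covered vertices would give
   an edge of M that can be swapped into N, contradicting the choice of N. *)
Lemma missed_trans A M u v w : matching_in e A M -> #|M| = beta_on e A ->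
  u \notin cover M -> w \notin cover M -> u != w -> v \in cover M ->
  (exists2 N, matching_in e A N & #|N| = beta_on e A /\ v \notin cover N) ->
  exists N, [/\ matching_in e A N, #|N| = beta_on e A, v \notin cover N &
    (u \notin cover N) || (w \notin cover N)].
Proof.
move=> mM bM nMu nMw nuw Mv [N0 mN0 [bN0 nN0v]].
pose P N := [&& matching_in e A N, #|N| == beta_on e A & v \notin cover N].
have PN0 : P N0 by rewrite /P mN0 bN0 eqxx.
case: (arg_maxnP (fun N => #|M :&: N|) PN0) => N /and3P[mN /eqP bN nNv] maxN.
exists N; split=> //; rewrite -negb_and; apply/negP => /andP[Nu Nw].
have eqMN : #|cover M| = #|cover N| by rewrite !(matching_cover_card mM, matching_cover_card mN) bM bN.
have card2 : 1 < #|cover M :\: cover N|.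
  have : [set u; w] \subset cover N :\: cover M.
    by rewrite subUset !sub1set !inE nMu nMw Nu Nw.
  move/subset_leq_card; rewrite cards2 nuw /=.
  have := cardsID (cover N) (cover M); have := cardsID (cover M) (cover N).
  by move: eqMN; rewrite setIC; clear; lia.
(* One of the two vertices lost by [N] is not [v]. Its partner in [M] is covered by [N], hence is
   not [v] either, so the swap leaves [v] uncovered. *)
have [x] : exists x, x \in (cover M :\: cover N) :\ v.
  by apply/card_gt0P; move: card2; rewrite (cardsD1 v); case: (_ \in _); clear; lia.
case/setD1P=> nxv /setDP[/bigcupP[E EM Ex] nNx].
have [HM tM] := matchingP _ _ mM; have [HN tN] := matchingP _ _ mN.
have [y [Ax Ay exy defE]] : exists y, [/\ x \in A, y \in A, e x y & E = [set x; y]].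
  have [a [b [Aa Ab eab defE]]] := HM E EM.
  move: Ex; rewrite defE => /set2P[]->; first by exists b.
  by exists a; rewrite e_sym setUC.
have Ny : y \in cover N.
  by have := maximum_matching_edge mN bN Ax Ay exy; rewrite (negPf nNx).
have /bigcupP[F FN Fy] := Ny.
have nFx : x \notin F by apply: contra nNx => Fx; apply/bigcupP; exists F.
have nFE : F != E by apply: contraNneq nFx => ->.
have nFM : F \notin M.
  apply/negP => FM; have := trivIsetP tM _ _ FM EM nFE.
  by move/pred0P/(_ y); rewrite /= Fy defE set22.
have nEN : E \notin N by apply: contra nNx => EN; apply/bigcupP; exists E.
have dE : [disjoint E & cover (N :\ F)].
  apply/pred0P => z /=; apply/negbTE/negP => /andP[].
  rewrite defE => /set2P[]-> /bigcupP[F' /setD1P[nF' F'N] F'z].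
    by case/negP: nNx; apply/bigcupP; exists F'.
  by have /pred0P/(_ y) := trivIsetP tN _ _ F'N FN nF'; rewrite /= F'z Fy.
have [mN' cN'] := matchingU1 (matchingS (subsetDl N [set F]) mN) (HM E EM) dE.
have cN1 := cardsD1 F N; rewrite FN in cN1.
have PN' : P (E |: N :\ F).
  rewrite /P mN' cN' -bN cN1 eqxx /=; apply/negP => /bigcupP[F' /setU1P[->|/setD1P[_ F'N]] F'v].
    move: F'v; rewrite defE => /set2P[vx|vy]; first by rewrite vx eqxx in nxv.
    by rewrite vy Ny in nNv.
  by case/negP: nNv; apply/bigcupP; exists F'.
have /= := maxN _ PN'; rewrite leqNgt => /negP; apply.
have -> : M :&: (E |: N :\ F) = E |: (M :&: N).
  apply/setP => F'; rewrite !inE; case: (eqVneq F' E) => [->|_] /=; first by rewrite EM.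
  by case: (eqVneq F' F) => [->|]; rewrite ?(negPf nFM).
by rewrite cardsU1 inE EM (negPf nEN).
Qed.

(** Phrased through [detached], so that its failure is exactly a splitting to which additivity
    applies. *)
Definition connected_set A := forall B, detached A B -> B != set0 -> B = A.

(** Fix [u]. Together with [u], the vertices that no maximum matching misses along with [u] form a
    set closed under adjacency, hence all of [A]. A maximum matching missing [u] therefore covers
    everything else. *)
Lemma gallai A : connected_set A -> A != set0 ->
  (forall v, v \in A -> beta_on e A <= beta_on e (A :\ v)) ->
  #|A| = (beta_on e A).*2.+1.
Proof.
move=> cA /set0Pn[u Au] Hb.
have miss v : v \in A -> exists2 N, matching_in e A N & #|N| = beta_on e A /\ v \notin cover N.
  move=> Av; have [N mN bN] := beta_witness (A :\ v).
  have mNA : matching_in e A N.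
    have [HN tN] := matchingP _ _ mN; apply/matchingP; split=> // E /HN.
    by apply: edge_sub; apply: subsetDl.
  exists N => //; split.
    by apply/eqP; rewrite eqn_leq leq_beta //= bN Hb.
  by apply/negP => /(subsetP (matching_cover_sub mN)); rewrite !inE eqxx.
pose both v w := [exists N, [&& matching_in e A N, #|N| == beta_on e A,
                               v \notin cover N & w \notin cover N]].
pose B := [set v in A | (v == u) || ~~ both u v].
have BA : B = A.
  apply: cA; last by apply/set0Pn; exists u; rewrite inE Au eqxx.
  apply/detachedP; split; first by apply/subsetP => x; rewrite inE => /andP[].
  move=> v w; rewrite !inE => /andP[Av Hv] Aw evw; rewrite Aw /=.
  case: eqVneq => //= nwu; apply/negP => /existsP[M /and4P[mM /eqP bM nMu nMw]].
  have Mv : v \in cover M.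
    by have := maximum_matching_edge mM bM Av Aw evw; rewrite (negPf nMw) orbF.
  have nvu : v != u by apply: contraNneq nMu => <-.
  rewrite (negPf nvu) /= in Hv.
  rewrite eq_sym in nwu.
  (* [N] misses either both [u] and [v], against the choice of [v], or both ends of the edge from
     [v] to [w]. *)
  have [N [mN bN nNv]] := missed_trans mM bM nMu nMw nwu Mv (miss v Av).
  case/orP => [nNu|nNw].
    by case/negP: Hv; apply/existsP; exists N; rewrite mN bN eqxx nNu nNv.
  by have := maximum_matching_edge mN bN Av Aw evw; rewrite (negPf nNv) (negPf nNw).
have [M mM [bM nMu]] := miss u Au.
have defA : A = u |: cover M.
  apply/eqP; rewrite eqEsubset subUset sub1set Au (matching_cover_sub mM) !andbT.
  apply/subsetP => v Av; have : v \in B by rewrite BA.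
  rewrite !inE Av /=; case/orP => [->//|nb]; apply/orP; right.
  by apply: contraR nb => nMv; apply/existsP; exists M; rewrite mM bM eqxx nMu nMv.
by rewrite defA cardsU1 nMu (matching_cover_card mM) -defA bM muln2.
Qed.

(** * Shearer's lower bound on the independence number *)

Hypothesis tri_free : triangle_free e.

Notation deg A v := #|nbr A v|.

(* Shearer's function f(0) = 1, f(d) = (1 + (d^2 - d) f(d-1)) / (d^2 + 1),
   scaled by 850; [shearer_gap d] is 850 (f(d-1) - f(d)). *)
Definition shearer_weight d := nth 0 [:: 850; 425; 340; 289; 254] d.
Definition shearer_gap d := nth 0 [:: 0; 425; 85; 51; 35] d.

(** The recursion for f, rearranged as (d + 1) f(d) = 1 + d (d - 1) (f(d-1) - f(d)). *)
Lemma shearer_weight_recursion d : d <= 4 ->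
  d.+1 * shearer_weight d <= 850 + d * (d.-1 * shearer_gap d).
Proof. by case: d => [|[|[|[|[|d]]]]]. Qed.

(** Gaps shrink as the degree grows, so each of the [k] steps down from [d] gains at least
    [shearer_gap d]. *)
Lemma shearer_weight_convex d k : d <= 4 -> k <= d ->
  shearer_weight d + k * shearer_gap d <= shearer_weight (d - k).
Proof.
by case: d => [|[|[|[|[|d]]]]] //; case: k => [|[|[|[|[|k]]]]].
Qed.

(** Rearrangement inequality: on positive degrees the predecessor increases while the gap decreases.
    The value [shearer_gap 0 = 0] breaks this monotonicity, whence the positivity. *)
Lemma shearer_gap_rearrangement a b : 0 < a <= 4 -> 0 < b <= 4 ->
  a.-1 * shearer_gap a + b.-1 * shearer_gap b <=
  a.-1 * shearer_gap b + b.-1 * shearer_gap a.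
Proof.
by case: a => [|[|[|[|[|a]]]]] //; case: b => [|[|[|[|[|b]]]]].
Qed.

Lemma sum_nbr_sym A (h : T -> T -> nat) :
  \sum_(v in A) \sum_(u in nbr A v) h v u =
  \sum_(u in A) \sum_(v in nbr A u) h v u.
Proof.
rewrite (exchange_big_dep (mem A)) /=; last by move=> v u _; rewrite inE => /andP[].
apply: eq_bigr => u Au; apply: eq_bigl => v.
by rewrite !inE Au e_sym.
Qed.

Lemma sum_setD1 (N : {set T}) (h : T -> nat) :
  \sum_(v in N) \sum_(w in N :\ v) h w = \sum_(w in N) #|N|.-1 * h w.
Proof.
rewrite (exchange_big_dep (mem N)) /=; last by move=> v w _ /setD1P[].
apply: eq_bigr => w Nw; rewrite sum_nat_cond_const.
congr (_ * _); rewrite (cardsD1 w N) Nw /=; apply: eq_card => v.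
by rewrite !inE Nw eq_sym !andbT andbC.
Qed.

(** Averaging shows that some vertex is good to delete. After double counting, rearrangement
    replaces the gap at a neighbour by the gap at the vertex itself, and the recursion finishes
    vertex by vertex. *)
Lemma shearer_average A : (forall v, v \in A -> deg A v <= 4) ->
  \sum_(v in A) (shearer_weight (deg A v) +
                 \sum_(u in nbr A v) shearer_weight (deg A u)) <=
  \sum_(v in A) (850 + \sum_(u in nbr A v) \sum_(w in nbr A u :\ v)
                          shearer_gap (deg A w)).
Proof.
move=> d4; rewrite !big_split /= [X in _ + X <= _]sum_nbr_sym [X in _ <= _ + X]sum_nbr_sym.
under [X in _ <= _ + X]eq_bigr => u _ do rewrite sum_setD1.
under [X in _ + X <= _]eq_bigr => u _ do rewrite sum_nat_const.
set L := \sum_(u in A) \sum_(w in nbr A u) _.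
have le_rearr : \sum_(u in A) deg A u * ((deg A u).-1 * shearer_gap (deg A u)) <= L.
  (* Doubling lets each edge be read in both directions, so that rearrangement applies edge by
     edge. *)
  rewrite -leq_double -!addnn.
  under [X in X + _ <= _]eq_bigr => u _ do rewrite -sum_nat_const.
  under [X in _ + X <= _]eq_bigr => u _ do rewrite -sum_nat_const.
  rewrite [X in _ + X <= _](sum_nbr_sym _ (fun v u => (deg A v).-1 * shearer_gap (deg A v))).
  rewrite [X in _ <= _ + X](sum_nbr_sym A) /L -!big_split /=.
  apply: leq_sum => u Au; rewrite -!big_split /=; apply: leq_sum => w.
  rewrite inE => /andP[Aw euw]; apply: shearer_gap_rearrangement.
    by rewrite d4 // andbT; apply/card_gt0P; exists w; rewrite inE Aw.
  by rewrite d4 // andbT; apply/card_gt0P; exists u; rewrite inE Au e_sym.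
apply: leq_trans (leq_add (leqnn _) le_rearr).
rewrite -!big_split /=; apply: leq_sum => u Au.
by rewrite -mulSn; apply: shearer_weight_recursion; apply: d4.
Qed.

(** Delete a good vertex [v] with its neighbours. The weight lost is at most 850 plus the gain of
    the surviving vertices, whose degrees drop, while [alpha_on] falls by at least one. *)
Lemma shearer A : (forall v, v \in A -> deg A v <= 4) ->
  \sum_(v in A) shearer_weight (deg A v) <= 850 * alpha_on e A.
Proof.
have [n] := ubnP #|A|; elim: n A => // n IH A leAn d4.
have [->|/set0Pn[v0 Av0]] := eqVneq A set0; first by rewrite big_set0.
have [v Av good] : exists2 v, v \in A & shearer_weight (deg A v) +
    \sum_(u in nbr A v) shearer_weight (deg A u) <=
    850 + \sum_(u in nbr A v) \sum_(w in nbr A u :\ v) shearer_gap (deg A w).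
  apply/exists_inP; apply: contraLR (shearer_average d4) => /exists_inPn bad.
  rewrite -ltnNge; set Y := (X in X < _).
  (* Each bad vertex contributes a slack of one, and [A] is nonempty. *)
  have : Y + #|A| <= \sum_(v in A) (shearer_weight (deg A v) +
    \sum_(u in nbr A v) shearer_weight (deg A u)).
    rewrite -sum1_card /Y -big_split /=; apply: leq_sum => v Av.
    by rewrite addn1 ltnNge bad.
  by apply: leq_trans; rewrite -addn1 leq_add2l; apply/card_gt0P; exists v0.
pose A' := A :\: (v |: nbr A v).
have sA' : A' \subset A by apply: subsetDl.
(* A survivor loses exactly the neighbours it shares with [v]. *)
have dA' w : w \in A' ->
    shearer_weight (deg A w) + #|nbr A v :&: nbr A w| * shearer_gap (deg A w)
    <= shearer_weight (deg A' w).
  move=> A'w; have Aw := subsetP sA' _ A'w.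
  have nwv : e w v = false.
    by move: A'w; rewrite !inE Aw e_sym /= andbT => /norP[_ /negPf].
  have -> : nbr A' w = nbr A w :\: nbr A v.
    apply/setP => x; rewrite !inE; case: (eqVneq x v) => [->|_] /=.
      by rewrite nwv !andbF.
    by rewrite andbA.
  rewrite cardsD setIC; apply: shearer_weight_convex; first exact: d4.
  by apply: subset_leq_card; apply: subsetIl.
have cA' : #|A'| < n.
  apply: leq_trans (_ : #|A| <= n) => //; apply: proper_card.
  apply/properP; split=> //; exists v => //; by rewrite !inE eqxx.
have d4' w : w \in A' -> deg A' w <= 4.
  move=> A'w; apply: leq_trans (d4 w (subsetP sA' _ A'w)); apply: subset_leq_card.
  by apply/subsetP => x; rewrite !inE => /andP[/andP[_ ->]].
have := IH A' cA' d4'; have := alphaU1 Av; rewrite -/A'.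
have : \sum_(w in A') (shearer_weight (deg A w) +
    #|nbr A v :&: nbr A w| * shearer_gap (deg A w)) <=
    \sum_(w in A') shearer_weight (deg A' w) by apply: leq_sum.
rewrite big_split /=.
(* The gain is regrouped by shared neighbour [u]. Triangle-freeness ensures that every other
   neighbour of [u] survives. *)
have -> : \sum_(w in A') #|nbr A v :&: nbr A w| * shearer_gap (deg A w) =
  \sum_(u in nbr A v) \sum_(w in nbr A u :\ v) shearer_gap (deg A w).
  under eq_bigr => w _ do rewrite -sum_nat_const.
  rewrite (exchange_big_dep (mem (nbr A v))) /=; last by move=> w u _ /setIP[].
  apply: eq_bigr => u Nu; apply: eq_bigl => w.
  move: Nu; rewrite !inE => /andP[Au evu]; rewrite Au evu /= [e w u]e_sym.
  case: (boolP (e u w)) => euw; rewrite ?andbF //= !andbT negb_or.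
  have -> : e v w = false by apply/negP; apply: (tri_free evu euw).
  by rewrite andbF !andbT.
have <- : shearer_weight (deg A v) + \sum_(u in nbr A v) shearer_weight (deg A u) +
    \sum_(w in A') shearer_weight (deg A w) = \sum_(u in A) shearer_weight (deg A u).
  rewrite [RHS](bigID (mem (v |: nbr A v))) /=; congr (_ + _).
    transitivity (\sum_(u in v |: nbr A v) shearer_weight (deg A u)).
      by rewrite big_setU1 //= inE e_irr andbF.
    apply: eq_bigl => x; rewrite !inE.
    by case: eqVneq => [->|_]; rewrite ?Av //=; case: (x \in A).
  by apply: eq_bigl => x; rewrite /A' inE andbC.
lia.
Qed.

Lemma shearer_deg4 A : (forall v, v \in A -> deg A v <= 4) ->
  254 * #|A| <= 850 * alpha_on e A.
Proof.
move=> d4; apply: leq_trans (shearer d4); rewrite mulnC -sum_nat_const.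
by apply: leq_sum => v /d4; case: #|_| => [|[|[|[|[|d]]]]].
Qed.

Lemma shearer_deg3 A : (forall v, v \in A -> deg A v <= 3) ->
  289 * #|A| <= 850 * alpha_on e A.
Proof.
move=> d3; have d4 v : v \in A -> deg A v <= 4 by move=> /d3 /leqW.
apply: leq_trans (shearer d4); rewrite mulnC -sum_nat_const.
by apply: leq_sum => v /d3; case: #|_| => [|[|[|[|d]]]].
Qed.

(** * Rigidity of 13-vertex sets with independence number 4 *)

Lemma deg_le_alpha A v : deg A v <= alpha_on e A.
Proof.
apply: leq_alpha; apply/independentP; split.
  by apply/subsetP => x; rewrite inE => /andP[].
move=> x y; rewrite !inE => /andP[_ evx] /andP[_ evy]; apply/negP => exy.
exact: tri_free evx exy evy.
Qed.

Lemma deg_alpha4_card13 A v : v \in A -> #|A| = 13 -> alpha_on e A = 4 -> 4 <= deg A v.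
Proof.
move=> Av cA aA; rewrite leqNgt; apply/negP => dv.
have := alphaU1 Av; rewrite aA; set A' := A :\: _ => aA'.
have : 9 <= #|A'|.
  have := subset_leq_card (subsetIr A (v |: nbr A v)).
  have := cardsID (v |: nbr A v) A.
  by rewrite cardsU1 inE e_irr andbF cA /= -/A'; move: dv; clear; lia.
(* Degrees in [A'] are at most [alpha_on e A' <= 3], yet [289 * 9 = 2601] exceeds
   [850 * 3 = 2550]. *)
have := @shearer_deg3 A' (fun w _ => leq_trans (deg_le_alpha A' w) aA').
by move: aA'; clear; lia.
Qed.

Hypothesis deg4 : max_degree_le e 4.

Lemma deg_le4 A v : deg A v <= 4.
Proof.
apply: leq_trans (deg4 v); apply: subset_leq_card.
by apply/subsetP => x; rewrite !inE => /andP[].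
Qed.

(** Four neighbours of [v] already lie in [A], and the degree bound in the whole graph leaves room
    for no other. *)
Lemma detached_card13 A v w : #|A| = 13 -> alpha_on e A = 4 -> v \in A -> e v w -> w \in A.
Proof.
move=> cA aA Av evw; have := deg_alpha4_card13 Av cA aA.
have sN : nbr A v \subset [set y | e v y] by apply/subsetP => x; rewrite !inE => /andP[].
move=> d; have /eqP eqN : nbr A v == [set y | e v y].
  by rewrite eqEcard sN (leq_trans (deg4 v)).
by have : w \in nbr A v; [rewrite eqN inE | rewrite inE => /andP[]].
Qed.

(** * The induction for the bound and its equality case *)

Definition extremal_block B := [/\ #|B| = 13, alpha_on e B = 4 & beta_on e B = 6].

(** Stated relative to [A], so that it passes from detached pieces to their union; for the whole
    vertex set the blocks turn out to be the components. *)
Definition extremal_cover A := forall x, x \in A ->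
  exists B, [/\ x \in B, detached A B, connected_set B & extremal_block B].

(** With n = 2 beta + 1 the bound reads 2 n + 2 <= 7 alpha. Shearer's bound rounded up gives this
    for every odd n except 3, with equality only at n = 13. *)
Lemma bound_factor_critical A : #|A| = (beta_on e A).*2.+1 ->
  4 * #|A| <= 7 * alpha_on e A + 4 * beta_on e A /\
  (4 * #|A| = 7 * alpha_on e A + 4 * beta_on e A -> extremal_block A).
Proof.
move=> cA; have s4 := @shearer_deg4 A (fun v _ => deg_le4 A v).
(* Three vertices have degrees at most 3, and [289 * 3 = 867] exceeds 850. *)
have n3 : #|A| = 3 -> 1 < alpha_on e A.
  move=> c3; have := @shearer_deg3 A; rewrite c3.
  have d3 v : v \in A -> deg A v <= 3.
    move=> _; rewrite -c3; apply: subset_leq_card.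
    by apply/subsetP => x; rewrite inE => /andP[].
  by move/(_ d3); lia.
by split; [|split]; lia.
Qed.

Lemma bound_on A :
  4 * #|A| <= 7 * alpha_on e A + 4 * beta_on e A /\
  (4 * #|A| = 7 * alpha_on e A + 4 * beta_on e A -> extremal_cover A).
Proof.
have [n] := ubnP #|A|; elim: n A => // n IH A leAn.
have [A0|nA0] := eqVneq A set0.
  by split=> [|_ x]; rewrite A0 ?cards0 ?inE.
have [/existsP[B /and3P[dB nB0 nBA]]|conn] :=
  boolP [exists B, [&& detached A B, B != set0 & B != A]].
  have sBA : B \subset A by have [] := detachedP _ _ dB.
  have := cardsID B A; rewrite (setIidPr sBA) => cAB.
  have B0 : 0 < #|B| by rewrite card_gt0.
  have ltBA : #|B| < #|A| by rewrite proper_card // properEneq nBA.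
  have [|leB eqB] := IH B; first by lia.
  have [|leD eqD] := IH (A :\: B); first by lia.
  rewrite (alpha_detached dB) (beta_detached dB); split; first by lia.
  move=> eqA x Ax; have [Bx|nBx] := boolP (x \in B).
    have [|C [Cx dC cC xC]] := eqB _ x Bx; first by lia.
    by exists C; split=> //; apply: detached_trans dC.
  have [||C [Cx dC cC xC]] := eqD _ x; [by lia | by rewrite inE nBx |].
  by exists C; split=> //; apply: detached_trans dC; apply: detachedD.
have cA : connected_set A.
  move=> B dB nB0; apply: contraNeq conn => nBA.
  by apply/existsP; exists B; rewrite dB nB0.
have [/exists_inP[v Av ltb]|stable] := boolP [exists v in A, beta_on e (A :\ v) < beta_on e A].
  have cAv := cardsD1 v A; rewrite Av in cAv.
  have aAv := alpha_sub (subsetDl A [set v]).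
  have [|leD eqD] := IH (A :\ v); first by lia.
  split=> [|eqA]; first by lia.
  (* Deleting [v] costs one vertex and at least one in beta, and does not raise alpha, so equality
     for [A] forces equality for [A :\ v]. *)
  have covD : extremal_cover (A :\ v) by apply: eqD; lia.
  have N0 : nbr A v = set0.
    apply/setP => x; rewrite !inE; apply/negP => /andP[Ax evx].
    have [|B [Bx dB _ [cB aB _]]] := covD x.
      by rewrite !inE Ax andbT; apply: contraTneq evx => ->; rewrite e_irr.
    have [/subsetP sB _] := detachedP _ _ dB.
    have /sB : v \in B by apply: (detached_card13 cB aB Bx); rewrite e_sym.
    by rewrite !inE eqxx.
  (* As [v] is isolated, its deletion also lowers alpha, contradicting equality. *)
  by have := alphaU1 Av; rewrite N0 setU0; lia.
have cardA : #|A| = (beta_on e A).*2.+1.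
  apply: gallai => // v Av; rewrite leqNgt; apply: contra stable => ltb.
  by apply/exists_inP; exists v.
have [le eq] := bound_factor_critical cardA; split=> // eqA x Ax.
exists A; split=> //; last exact: eq.
by apply/detachedP.
Qed.

(** * Passage to connected components *)

Lemma mem_component x : x \in component e x.
Proof. by rewrite inE connect0. Qed.

(** A path starting in a set closed under adjacency never leaves it. *)
Lemma component_detached A x : detached setT A -> x \in A -> detached A (component e x).
Proof.
case/detachedP=> _ dA Ax; apply/detachedP; split.
  apply/subsetP => y; rewrite inE => /connectP[p].
  elim: p x Ax => [|z p IHp] x Ax /=; first by move=> _ ->.
  by case/andP=> exz pz; apply: (IHp z) => //; apply: (dA x); rewrite ?inE.
move=> y z; rewrite !inE => cy _ eyz; exact: connect_trans cy (connect1 eyz).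
Qed.

(** Components are split off one at a time; each contributes [4 * 13 = 7 * 4 + 4 * 6]. *)
Lemma sum_components A : detached setT A ->
  (forall x, extremal_block (component e x)) ->
  4 * #|A| = 7 * alpha_on e A + 4 * beta_on e A.
Proof.
move=> dA comp; have [n] := ubnP #|A|; elim: n A dA => // n IH A dA leAn.
have [A0|/set0Pn[x Ax]] := eqVneq A set0.
  have [+ _] := bound_on A; rewrite A0 cards0.
  have [S /independentP[+ _] <-] := alpha_witness set0.
  have [M mM <-] := beta_witness set0.
  have := matching_cover_card mM; have := matching_cover_sub mM.
  rewrite !subset0 => /eqP->; rewrite cards0 => M0 /eqP->; rewrite cards0; lia.
have dC := component_detached dA Ax; have [sCA _] := detachedP _ _ dC.
have [cC aC bC] := comp x.
have := cardsID (component e x) A; rewrite (setIidPr sCA) cC => cA.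
rewrite (alpha_detached dC) (beta_detached dC) aC bC.
have : 4 * #|A :\: component e x| =
  7 * alpha_on e (A :\: component e x) + 4 * beta_on e (A :\: component e x).
  by apply: IH; [apply: detached_trans dA (detachedD dC) | lia].
lia.
Qed.

(** The component of [x] is detached in the connected block containing [x], hence equals that
    block. *)
Lemma extremal_cover_component x : extremal_cover setT -> extremal_block (component e x).
Proof.
move/(_ x (in_setT x)) => [B [Bx dB cB]].
rewrite -(cB (component e x)) //; first exact: component_detached.
by apply/set0Pn; exists x; apply: mem_component.
Qed.

End Sets.

(* 7/4 alpha + beta >= n  is written  7 alpha + 4 beta >= 4 n  (in nat). *)
Theorem theorem1 (T : finType) (e : rel T) :
  simple_graph e -> triangle_free e -> max_degree_le e 4 ->
  4 * #|T| <= 7 * alpha e + 4 * beta e /\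
  (4 * #|T| = 7 * alpha e + 4 * beta e <->
   forall x : T,
     [/\ #|component e x| = 13,
         alpha_on e (component e x) = 4 &
         beta_on e (component e x) = 6]).
Proof.
move=> [e_sym e_irr] tri_free deg4.
have [le eq] := bound_on e_sym e_irr tri_free deg4 [set: T].
rewrite cardsT in le eq; split=> //; split=> [/eq cov x|comp].
  exact: extremal_cover_component.
rewrite -cardsT; apply: sum_components => //.
by apply/detachedP; split=> [|x y _ _ _]; rewrite ?inE.
Qed.
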